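(* For any two predicates $P,Q$ and any concrete program $S$, if $\models_{\mathrm{par}}\{P\}\,S\,\{Q\}$, then $\{P\}\,\square\,\{Q\}\hookrightarrow_{\mathrm{par}}^{*}S$.
   Context: Quantum setting. There is a finite set $\mathrm{qVars}$ of quantum variables; each $q$ has Hilbert space $\mathcal H_q=\mathbb C^{\Sigma_q}$ ($\Sigma_q$ finite) with standard orthonormal basis $\{|x\rangle\}_{x\in\Sigma_q}$. For a set $\vec q\subseteq\mathrm{qVars}$, $\mathcal H_{\vec q}=\bigotimes_{q\in\vec q}\mathcal H_q$ with standard basis labelled by $\Sigma_{\vec q}=\prod_{q\in\vec q}\Sigma_q$, and $\mathcal H=\mathcal H_{\mathrm{qVars}}$. For an operator $A$ on $\mathcal H_{\vec q}$, $A_{\vec q}=A\otimes I$ on $\mathcal H$. $\preceq$ is the Löwner order. A partial state is a positive semidefinite (PSD) $\rho$ on $\mathcal H$ with $\operatorname{tr}\rho\le1$. A predicate is an operator $P$ on $\mathcal H$ with $0\preceq P\preceq I$; ''$P\Rightarrow Q$'' means $P\preceq Q$. A measurement on $\vec q$ is a family $\vec M=\{M_\omega\}_{\omega\in\Omega}$ ($\Omega$ finite) of PSD operators on $\mathcal H_{\vec q}$ with $\sum_\omega M_\omega=I$; write $\mathcal M_{\omega}(X)=\sqrt{M_{\omega,\vec q}}\,X\,\sqrt{M_{\omega,\vec q}}$. A binary measurement is given by an operator $B$ on $\mathcal H_{\vec q}$ with $0\preceq B\preceq I$, and $\mathcal B_{0,\vec q}(X)=\sqrt{(I-B)_{\vec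 q}}\,X\sqrt{(I-B)_{\vec q}}$, $\mathcal B_{1,\vec q}(X)=\sqrt{B_{\vec q}}\,X\sqrt{B_{\vec q}}$. Quantum while language: $S::=\mathbf{skip}\mid \vec q:=|0\rangle\mid \vec q\mathrel{*}=U\mid S_1;S_2\mid \mathbf{repeat}\ N\ \mathbf{do}\ S\mid \mathbf{case}\ \vec M[\vec q]\ \mathbf{of}\ \{\omega: S_\omega\}_{\omega\in\Omega}\mid \mathbf{while}\ B[\vec q]\ \mathbf{do}\ S$, with $U$ unitary on $\mathcal H_{\vec q}$, $N\in\mathbb N$. Denotational semantics $[\![S]\!]$ on partial states: $[\![\mathbf{skip}]\!](\rho)=\rho$; $[\![\vec q:=|0\rangle]\!](\rho)=\sum_{x\in\Sigma_{\vec q}}|0\rangle\langle x|_{\vec q}\,\rho\,|x\rangle\langle0|_{\vec q}$; $[\![\vec q\mathrel{*}=U]\!](\rho)=U_{\vec q}\rho U_{\vec q}^\dagger$; $[\![S_1;S_2]\!]=[\![S_2]\!]\circ[\![S_1]\!]$; $[\![\mathbf{repeat}\ N\ \mathbf{do}\ S]\!]=[\![S]\!]^N$; $[\![\mathbf{case}\ldots]\!](\rho)=\sum_\omega[\![S_\omega]\!](\mathcal M_\omega(\rho))$; $[\![\mathbf{while}\ B[\vec q]\ \mathbf{do}\ S]\!](\rho)=\sum_{k\ge0}(\mathcal B_{0,\vec q}\circ([\![S]\!]\circ\mathcal B_{1,\vec q})^k)(\rho)$. Hoare triples: $\models_{\mathrm{tot}}\{P\}S\{Q\}$ iff $\operatorname{tr}(P\rho)\le\operatorname{tr}(Q[\![S]\!](\rho))$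 for all partial states $\rho$; $\models_{\mathrm{par}}\{P\}S\{Q\}$ iff $\operatorname{tr}(P\rho)\le\operatorname{tr}(Q[\![S]\!](\rho))+\operatorname{tr}\rho-\operatorname{tr}[\![S]\!](\rho)$ for all partial states $\rho$. Syntactic sugar: $\mathbf{if}\ B[\vec q]\ \mathbf{then}\ S_1\ \mathbf{else}\ S_0$ abbreviates $\mathbf{case}\ \{1:B,0:I-B\}[\vec q]\ \mathbf{of}\ \{1:S_1,0:S_0\}$; omitting else means $S_0=\mathbf{skip}$. Programs with holes. The grammar is extended by holes $\{P\}\,\square\,\{Q\}$ ($P,Q$ predicates); more generally a hole may carry a family of specifications $\{P_\lambda\}\,\square\,\{Q_\lambda\}$, $\lambda\in\Lambda$ (written e.g. $\{P,P'\}\square\{Q,Q'\}$ for two). A program without holes is concrete. A refinement rule applied to a hole with a family must have its side conditions satisfied for every $\lambda$; the predicates it introduces may depend on $\lambda$, but the syntactic program produced (variables, unitaries, measurements, $N$, $B$) is the same for all $\lambda$; holes it creates carry the families indexed by $\lambda$ together with any newly introduced index. Refinement for partial correctness $\hookrightarrow_{\mathrm{par}}$ (for predicates $P,Q$): (H.skip) $\{P\}\square\{Q\}\hookrightarrow\mathbf{skip}$ if $P\Rightarrow Q$; (H.init) $\{P\}\square\{Q\}\hookrightarrow\vec q:=|0\rangle$ if $P\Rightarrow\sum_{x\in\Sigma_{\vec q}}|x\rangle\langle0|_{\vec q}Q|0\rangle\langle x|_{\vec q}$; (H.unit) $\{P\}\square\{Q\}\hookrightarrow\vec q\mathrel{*}=U$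 if $P\Rightarrow U_{\vec q}^\dagger QU_{\vec q}$; (H.seq) $\{P\}\square\{Q\}\hookrightarrow\{P\}\square\{R\};\{R\}\square\{Q\}$ for any predicate $R$; (HP.split) $\{P\}\square\{Q\}\hookrightarrow\{P_\gamma\}\square\{Q_\gamma\}$ ($\gamma\in\Gamma$) if $P\Rightarrow\sum_\gamma p_\gamma P_\gamma$ and $\sum_\gamma p_\gamma Q_\gamma\Rightarrow Q$ for a probability distribution $(p_\gamma)$; (H.repeat) $\{P\}\square\{Q\}\hookrightarrow\mathbf{repeat}\ N\ \mathbf{do}\ \{R_j\}\square\{R_{j+1}\}$ (family over $j\in\{0,\dots,N-1\}$) for predicates $R_0,\dots,R_N$ with $P\Rightarrow R_0$, $R_N\Rightarrow Q$; (H.case) $\{P\}\square\{Q\}\hookrightarrow\mathbf{case}\ \vec M[\vec q]\ \mathbf{of}\ \{\omega:\{P_\omega\}\square\{Q\}\}_{\omega}$ if $P\Rightarrow\sum_\omega\mathcal M_\omega(P_\omega)$; (HP.while) $\{P\}\square\{Q\}\hookrightarrow\mathbf{while}\ B[\vec q]\ \mathbf{do}\ \{R\}\square\{\mathcal B_{0,\vec q}(Q)+\mathcal B_{1,\vec q}(R)\}$ for a predicate $R$ with $P\Rightarrow\mathcal B_{0,\vec q}(Q)+\mathcal B_{1,\vec q}(R)$. Composite rules: (C.seqL/C.seqR/C.repeat/C.case/C.while) if $S'\hookrightarrow S$ then replacing one occurrence of $S'$ as the left or right component of a sequence, the body of a repeat, one branch of a case, or the body of a while by $S$ is a refinement step.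 Refinement for total correctness $\hookrightarrow_{\mathrm{tot}}$ uses all (H.* ) and (C.* ) rules above but replaces (HP.while) by (HT.while): $\{P\}\square\{Q\}\hookrightarrow\mathbf{while}\ B[\vec q]\ \mathbf{do}\ \{R_{n+1}\}\square\{\mathcal B_{0,\vec q}(Q)+\mathcal B_{1,\vec q}(R_n)\}$ (family over $n\in\mathbb N$) for predicates $(R_n)_{n\in\mathbb N}$ with $R_0=0$, $R_n\Rightarrow R_{n+1}$, whose limit $R=\lim_n R_n$ satisfies $P\Rightarrow\mathcal B_{0,\vec q}(Q)+\mathcal B_{1,\vec q}(R)$; and replaces (HP.split) by (HT.split), identical except that $(p_\gamma)$ need only be nonnegative reals. $\hookrightarrow^k$ denotes $k$ steps and $\hookrightarrow^*$ the reflexive-transitive closure. *)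

(* Defs.v *)
From HB Require Import structures.
From mathcomp Require Import all_boot all_order all_algebra.
From mathcomp Require Import sesquilinear spectral.
From mathcomp Require Import complex.
From mathcomp Require Import boolp classical_sets topology normedtype sequences reals.
Import Order.TTheory GRing.Theory Num.Theory.
Import numFieldNormedType.Exports.

Set Implicit Arguments.
Unset Strict Implicit.
Unset Printing Implicit Defensive.

Local Open Scope ring_scope.
Local Open Scope sesquilinear_scope.

Section QuantumWhile.

Variable R : realType.
Local Notation C := (R[i]).

(* Quantum variables: a finite type V (= qVars).  Variable q has
   Sigma_q = 'I_(d q).+1, whose element ord0 is the basis label "0". *)
Variable V : finType.
Variable d : V -> nat.

(* Standard basis of H_qs for a set qs of variables: assignments of a label
   in Sigma_q to every q in qs (coordinates outside qs are forced to the
   unique element of 'I_1), i.e. a copy of prod_{q in qs} Sigma_q. *)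
Definition dim_in (qs : {set V}) (q : V) : nat := if q \in qs then d q else 0.
Definition basis (qs : {set V}) := {dffun forall q : V, 'I_(dim_in qs q).+1}.

Definition op (qs : {set V}) := 'M[C]_(#|{: basis qs}|).
Definition Op := op [set: V].
Definition Basis := basis [set: V].

Definition restr (qs : {set V}) (x : Basis) : basis qs :=
  [ffun q => inord (x q)].

(* A_qs = A (x) I on H *)
Definition lift (qs : {set V}) (A : op qs) : Op :=
  \matrix_(i, j)
    let x : Basis := enum_val i in let y : Basis := enum_val j in
    if [forall q, (q \notin qs) ==> (val (x q) == val (y q))]
    then A (enum_rank (restr qs x)) (enum_rank (restr qs y))
    else 0.

Definition ketbra (qs : {set V}) (a b : basis qs) : op qs :=
  delta_mx (enum_rank a) (enum_rank b).
Definition zero_lbl (qs : {set V}) : basis qs := [ffun q => ord0].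

Definition psd n (A : 'M[C]_n) : Prop :=
  forall v : 'cV[C]_n, 0 <= (v ^t* *m A *m v) 0 0.
Definition loewner n (A B : 'M[C]_n) : Prop := psd (B - A).
Definition is_pred (P : Op) : Prop := psd P /\ loewner P 1%:M.
Definition pstate (rho : Op) : Prop := psd rho /\ \tr rho <= 1.

Definition sqrtm n (A : 'M[C]_n) : 'M[C]_n :=
  xget 0 [set X | psd X /\ X *m X = A].

Definition kr (K X : Op) : Op := K *m X *m K.
Definition meas_map (qs : {set V}) (M : op qs) (X : Op) : Op :=
  kr (sqrtm (lift M)) X.
Definition bmeas0 (qs : {set V}) (B : op qs) (X : Op) : Op := meas_map (1%:M - B) X.
Definition bmeas1 (qs : {set V}) (B : op qs) (X : Op) : Op := meas_map B X.

Definition is_meas (qs : {set V}) k (M : 'I_k -> op qs) : Prop :=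
  (forall w, psd (M w)) /\ \sum_(w < k) M w = 1%:M.
Definition is_bin (qs : {set V}) (B : op qs) : Prop :=
  psd B /\ loewner B 1%:M.

(* Programs, possibly with holes.  A hole carries a family of specifications
   {P l} [] {Q l}, l in L. Measurement outcomes Omega are 'I_k. *)
Inductive prog : Type :=
| Skip
| Init (qs : {set V})
| Unit (qs : {set V}) (U : op qs)
| Seq (S1 S2 : prog)
| Repeat (N : nat) (T : prog)
| Case (qs : {set V}) (k : nat) (M : 'I_k -> op qs) (Sb : 'I_k -> prog)
| While (qs : {set V}) (B : op qs) (T : prog)
| Hole (L : Type) (P Q : L -> Op).

Fixpoint concrete (T : prog) : Prop :=
  match T with
  | Seq S1 S2 => concrete S1 /\ concrete S2
  | Repeat _ T => concrete T
  | Case _ _ _ Sb => forall w, concrete (Sb w)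
  | While _ _ T => concrete T
  | Hole _ _ _ => False
  | _ => True
  end.

Fixpoint wf (T : prog) : Prop :=
  match T with
  | Unit _ U => U \is unitarymx
  | Seq S1 S2 => wf S1 /\ wf S2
  | Repeat _ T => wf T
  | Case _ _ M Sb => is_meas M /\ forall w, wf (Sb w)
  | While _ B T => is_bin B /\ wf T
  | _ => True
  end.

Definition mlim (u : nat -> Op) : Op :=
  \matrix_(i, j) (@Complex R (limn (fun n => @complex.Re R (u n i j)))
                              (limn (fun n => @complex.Im R (u n i j))) : C).

Definition sem_init (qs : {set V}) (rho : Op) : Op :=
  \sum_(x : basis qs) lift (ketbra (zero_lbl qs) x) *m rho *m lift (ketbra x (zero_lbl qs)).

(* denotational semantics (holes are interpreted as skip; only used on
   concrete programs) *)
Fixpoint sem (T : prog) (rho : Op) : Op :=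
  match T with
  | Skip => rho
  | Init qs => sem_init qs rho
  | Unit qs U => lift U *m rho *m (lift U) ^t*
  | Seq S1 S2 => sem S2 (sem S1 rho)
  | Repeat N T => iter N (sem T) rho
  | Case qs k M Sb => \sum_(w < k) sem (Sb w) (meas_map (M w) rho)
  | While qs B T =>
      mlim (fun n => \sum_(k < n) bmeas0 B (iter k (fun X => sem T (bmeas1 B X)) rho))
  | Hole _ _ _ => rho
  end.

Definition par_valid (P : Op) (S : prog) (Q : Op) : Prop :=
  forall rho, pstate rho ->
    \tr (P *m rho) <= \tr (Q *m sem S rho) + \tr rho - \tr (sem S rho).

Definition init_pre (qs : {set V}) (Q : Op) : Op :=
  \sum_(x : basis qs) lift (ketbra x (zero_lbl qs)) *m Q *m lift (ketbra (zero_lbl qs) x).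

Inductive rstep_par : prog -> prog -> Prop :=
| H_skip L (P Q : L -> Op) :
    (forall l, loewner (P l) (Q l)) ->
    rstep_par (Hole P Q) Skip
| H_init L (P Q : L -> Op) (qs : {set V}) :
    (forall l, loewner (P l) (init_pre qs (Q l))) ->
    rstep_par (Hole P Q) (Init qs)
| H_unit L (P Q : L -> Op) (qs : {set V}) (U : op qs) :
    U \is unitarymx ->
    (forall l, loewner (P l) ((lift U) ^t* *m Q l *m lift U)) ->
    rstep_par (Hole P Q) (Unit U)
| H_seq L (P Q Rr : L -> Op) :
    (forall l, is_pred (Rr l)) ->
    rstep_par (Hole P Q) (Seq (Hole P Rr) (Hole Rr Q))
| HP_split L (P Q : L -> Op) (G : finType) (p : L -> G -> R) (P' Q' : L -> G -> Op) :
    (forall l g, 0 <= p l g) -> (forall l, \sum_g p l g = 1) ->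
    (forall l g, is_pred (P' l g) /\ is_pred (Q' l g)) ->
    (forall l, loewner (P l) (\sum_g (real_complex R (p l g)) *: P' l g)) ->
    (forall l, loewner (\sum_g (real_complex R (p l g)) *: Q' l g) (Q l)) ->
    rstep_par (Hole P Q)
      (Hole (fun lg : L * G => P' lg.1 lg.2) (fun lg : L * G => Q' lg.1 lg.2))
| H_repeat L (P Q : L -> Op) (N : nat) (Rr : L -> nat -> Op) :
    (forall l j, (j <= N)%N -> is_pred (Rr l j)) ->
    (forall l, loewner (P l) (Rr l 0%N)) ->
    (forall l, loewner (Rr l N) (Q l)) ->
    rstep_par (Hole P Q)
      (Repeat N (Hole (fun lj : L * 'I_N => Rr lj.1 (val lj.2))
                      (fun lj : L * 'I_N => Rr lj.1 (val lj.2).+1)))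
| H_case L (P Q : L -> Op) (qs : {set V}) (k : nat) (M : 'I_k -> op qs)
    (P' : L -> 'I_k -> Op) :
    is_meas M ->
    (forall l w, is_pred (P' l w)) ->
    (forall l, loewner (P l) (\sum_(w < k) meas_map (M w) (P' l w))) ->
    rstep_par (Hole P Q) (Case M (fun w => Hole (fun l => P' l w) Q))
| HP_while L (P Q : L -> Op) (qs : {set V}) (B : op qs) (Rr : L -> Op) :
    is_bin B ->
    (forall l, is_pred (Rr l)) ->
    (forall l, loewner (P l) (bmeas0 B (Q l) + bmeas1 B (Rr l))) ->
    rstep_par (Hole P Q)
      (While B (Hole Rr (fun l => bmeas0 B (Q l) + bmeas1 B (Rr l))))
| C_seqL S1 S1' S2 : rstep_par S1 S1' -> rstep_par (Seq S1 S2) (Seq S1' S2)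
| C_seqR S1 S2 S2' : rstep_par S2 S2' -> rstep_par (Seq S1 S2) (Seq S1 S2')
| C_repeat N S S' : rstep_par S S' -> rstep_par (Repeat N S) (Repeat N S')
| C_case (qs : {set V}) k (M : 'I_k -> op qs) (Sb : 'I_k -> prog) (w : 'I_k) S' :
    rstep_par (Sb w) S' ->
    rstep_par (Case M Sb) (Case M (fun v => if v == w then S' else Sb v))
| C_while (qs : {set V}) (B : op qs) S S' :
    rstep_par S S' -> rstep_par (While B S) (While B S').

Inductive refines_par : prog -> prog -> Prop :=
| rp_refl S : refines_par S S
| rp_step S1 S2 S3 : rstep_par S1 S2 -> refines_par S2 S3 -> refines_par S1 S3.

Definition hole1 (P Q : Op) : prog := Hole (fun _ : unit => P) (fun _ : unit => Q).

End QuantumWhile.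

(* Main.v *)
(* Every concrete program denotes a positive, trace-nonincreasing map f that has
   a dual f^* with tr(f^*(A) rho) = tr(A f(rho)).  For a loop, f^* is the limit of
   the increasing sequence A_0 = 0, A_(n+1) = B_0(A) + B_1(body^*(A_n)).  The
   operator wlp(Q) = I - f^*(I - Q) is a predicate, and partial validity of the
   triple is exactly the Loewner inequality P <= wlp(Q).  Since wlp obeys the
   compositional equations read off from the refinement rules, the program is
   rebuilt by structural induction, each rule being applied with weakest liberal
   preconditions as intermediate predicates.  The induction is run on families
   of specifications, because the repeat rule produces them. *)

From HB Require Import structures.
From mathcomp Require Import all_boot all_order all_algebra.
From mathcomp Require Import complex reals.
From mathcomp Require Import sesquilinear spectral ring.
From mathcomp Require Import boolp classical_sets topology normedtype sequences.
Require Import Defs.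
Import Order.TTheory GRing.Theory Num.Theory.
Import numFieldNormedType.Exports.

Set Implicit Arguments.
Unset Strict Implicit.
Unset Printing Implicit Defensive.

Local Open Scope ring_scope.
Local Open Scope sesquilinear_scope.

(** * Positive semidefinite matrices *)

Section Psd.

Variable R : realType.
Local Notation C := (R[i]).

Lemma adjM m n p (A : 'M[C]_(m, n)) (B : 'M[C]_(n, p)) :
  (A *m B)^t* = B^t* *m A^t*.
Proof. by rewrite trmx_mul map_mxM. Qed.

Lemma adjE m n (A : 'M[C]_(m, n)) i j : A^t* i j = (A j i)^*.
Proof. by rewrite !mxE. Qed.

Lemma tr_quad n (A : 'M[C]_n) (v : 'cV[C]_n) :
  (v^t* *m A *m v) 0 0 = \tr (A *m (v *m v^t*)).
Proof. by rewrite -[LHS]trace_mx11 -mulmxA mxtrace_mulC -mulmxA. Qed.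

(** With [L] the adjoint of [K] this is the duality of a Kraus map; with [L] equal to [K], the
    self-duality of a measurement map. *)
Lemma mxtrace_cycle n (A B K L : 'M[C]_n) :
  \tr (L *m A *m K *m B) = \tr (A *m (K *m B *m L)).
Proof.
by rewrite -(mulmxA (L *m A)) -(mulmxA L) mxtrace_mulC -(mulmxA A).
Qed.

Lemma psd_outer m n (X : 'M[C]_(n, m)) : psd (X *m X^t*).
Proof.
move=> v; rewrite mulmxA -mulmxA -[X in X *m _]trmxCK adjM trmxCK.
rewrite mxE sumr_ge0 // => i _.
by rewrite adjE mulrC mul_conjC_ge0.
Qed.

Lemma psd_conj m n (X : 'M[C]_(m, n)) (A : 'M[C]_n) :
  psd A -> psd (X *m A *m X^t*).
Proof.
move=> hA v; have := hA (X^t* *m v).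
by rewrite adjM trmxCK !mulmxA.
Qed.

Lemma psd0 n : psd (0 : 'M[C]_n).
Proof. by move=> v; rewrite mulmx0 mul0mx mxE. Qed.

Lemma psdD n (A B : 'M[C]_n) : psd A -> psd B -> psd (A + B).
Proof. by move=> hA hB v; rewrite mulmxDr mulmxDl mxE addr_ge0. Qed.

Lemma psdZ n (a : C) (A : 'M[C]_n) : 0 <= a -> psd A -> psd (a *: A).
Proof. by move=> ha hA v; rewrite -scalemxAr -scalemxAl mxE mulr_ge0. Qed.

Lemma psd_sum n (I : Type) (r : seq I) (p : pred I) (A : I -> 'M[C]_n) :
  (forall i, psd (A i)) -> psd (\sum_(i <- r | p i) A i).
Proof.
move=> hA; elim/big_rec: _ => [|i x _]; first exact: psd0.
exact: psdD.
Qed.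

Lemma psd_diag_ge0 n (A : 'M[C]_n) i : psd A -> 0 <= A i i.
Proof.
move=> /(_ (delta_mx i 0)); rewrite trmx_delta map_delta_mx -rowE -colE.
by rewrite !mxE.
Qed.

Lemma psd_tr_ge0 n (A : 'M[C]_n) : psd A -> 0 <= \tr A.
Proof. by move=> hA; rewrite sumr_ge0 // => i _; exact: psd_diag_ge0. Qed.

(** * Polarization: rank-one positive matrices span all matrices *)

Lemma polarization_ring (K : comPzRingType) (a b c e I : K) : I * I = -1 ->
  4 * (a * e) = (a + 1 * b) * (c + 1 * e) - (a + -1 * b) * (c + -1 * e)
    + I * ((a + I * b) * (c + - I * e)) - I * ((a + - I * b) * (c + - - I * e)).
Proof. by move=> hI; ring: hI. Qed.

Lemma outer_polarization n (u v : 'cV[C]_n) :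
  let w c := (u + c *: v) *m (u + c *: v)^t* in
  u *m v^t* = 4^-1 *: (w 1 - w (-1) + 'i *: w 'i - 'i *: w (- 'i)).
Proof.
move=> w.
have h4 : (4 : C) != 0 by rewrite pnatr_eq0.
apply: (scalerI h4); rewrite scalerA divff // scale1r.
apply/matrixP => i j.
have wE c : w c i j = (u i 0 + c * v i 0) * ((u j 0)^* + c^* * (v j 0)^*).
  have zE k : (u + c *: v) k 0 = u k 0 + c * v k 0 by rewrite !mxE.
  by rewrite mxE big_ord1 adjE !zE rmorphD rmorphM.
move: {w} (w) wE => w wE.
rewrite !mxE !wE.
rewrite big_ord1 adjE; change (@ord0 0) with (0 : 'I_1).
rewrite !rmorphN /= !conjCi !rmorph1.
have hi : 'i * 'i = -1 :> C by rewrite -expr2 sqrCi.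
(* Its ring variables are the entries of [u] and [v] at [i] and their conjugates at [j]; the second
   factors carry conjugated coefficients, hence the double negation of ['i]. *)
by apply: polarization_ring.
Qed.

Lemma tr_mul_delta n (A : 'M[C]_n) i j : \tr (A *m delta_mx j i) = A i j.
Proof.
rewrite -(mul_delta_mx (0 : 'I_1)) mulmxA mxtrace_mulC mulmxA -rowE -colE.
by rewrite trace_mx11 !mxE.
Qed.

(** A matrix is a combination of matrix units; each is an outer product of two vectors, which
    polarization writes through terms [v *m v^t*]. A property closed under combinations need only be
    checked on these. *)
Lemma outer_span_ind n (K : 'M[C]_n -> Prop) :
  (forall v : 'cV[C]_n, K (v *m v^t*)) ->
  (forall a X Y, K X -> K Y -> K (a *: X + Y)) ->
  forall X, K X.
Proof.
move=> Kv KL.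
have K0 : K 0.
  have /= := KL (-1) _ _ (Kv 0) (Kv 0).
  by rewrite mul0mx scaler0 addr0.
have KZ a X : K X -> K (a *: X) by move=> kX; rewrite -[_ *: _]addr0; exact: KL.
have KD X Y : K X -> K Y -> K (X + Y).
  by move=> kX kY; rewrite -[X]scale1r; exact: KL.
have KN X : K X -> K (- X) by move=> kX; rewrite -scaleN1r; exact: KZ.
move=> X; rewrite [X]matrix_sum_delta.
elim/big_rec: _ => [//|i Y _ KY]; apply: (KD) => //.
elim/big_rec: _ => [//|j Z _ hZ]; apply: (KD) => //; apply: (KZ).
have -> : delta_mx i j = delta_mx i 0 *m (delta_mx j (0 : 'I_1))^t* :> 'M[C]_n.
  by rewrite trmx_delta map_delta_mx mul_delta_mx.
rewrite outer_polarization.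
by apply: (KZ); apply: (KD); [apply: (KD); [apply: (KD)|]|]; try apply: (KN);
  try apply: (KZ); exact: Kv.
Qed.

Lemma psd_tr_inj n (A B : 'M[C]_n) :
  (forall X, psd X -> \tr (A *m X) = \tr (B *m X)) -> A = B.
Proof.
move=> h; apply/matrixP => i j; rewrite -!tr_mul_delta.
move: (delta_mx j i); apply: outer_span_ind => [v|a X Y hX hY].
  by apply: h; exact: psd_outer.
by rewrite !mulmxDr -!scalemxAr !mxtraceD !mxtraceZ hX hY.
Qed.

(** Each value [v^t* *m A *m v] is real, so [A] and its adjoint have the same trace against every
    [v *m v^t*], hence against every matrix unit. *)
Lemma psd_adj n (A : 'M[C]_n) : psd A -> A^t* = A.
Proof.
move=> hA; apply/matrixP => i j; rewrite -!tr_mul_delta.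
move: (delta_mx j i); apply: outer_span_ind => [v|a X Y hX hY]; last first.
  by rewrite !mulmxDr -!scalemxAr !mxtraceD !mxtraceZ hX hY.
rewrite -!tr_quad; set z := RHS.
have -> : v^t* *m A^t* *m v = (v^t* *m A *m v)^t*.
  by rewrite !adjM trmxCK mulmxA.
by rewrite adjE; apply/CrealP; apply: ger0_real; exact: hA.
Qed.

(** * Spectral decomposition and square roots *)

Lemma psd_spectral n (A : 'M[C]_n) : psd A ->
  exists U : 'M[C]_n, exists d : 'rV[C]_n,
    [/\ U \is unitarymx, forall i, 0 <= d 0 i & A = U^t* *m diag_mx d *m U].
Proof.
move=> hA.
have nA : A \is normalmx by apply/normalmxP; rewrite psd_adj.
have hU := spectral_unitarymx A.
have eA := @orthomx_spectralP _ _ A nA.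
rewrite (invmx_unitary hU) in eA.
exists (spectralmx A), (spectral_diag A); split=> // i.
(* The eigenvalues are the diagonal entries of [A] conjugated into its eigenbasis, which is again
   positive. *)
have := @psd_diag_ge0 _ _ i (psd_conj (spectralmx A) hA).
rewrite {2}eA !mulmxA (unitarymxP hU) mul1mx -mulmxA (unitarymxP hU) mulmx1.
by rewrite mxE eqxx.
Qed.

Lemma psd_diag n (d : 'rV[C]_n) : (forall i, 0 <= d 0 i) -> psd (diag_mx d).
Proof.
move=> hd v; rewrite -mulmxA mxE sumr_ge0 // => i _.
rewrite mul_diag_mx !mxE mulrCA mulr_ge0 //.
by rewrite mulrC mul_conjC_ge0.
Qed.

Lemma psd_conj_adj n (U A : 'M[C]_n) : psd A -> psd (U^t* *m A *m U).
Proof. by move=> /(psd_conj (U^t*)); rewrite trmxCK. Qed.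

Lemma unitary_conjM n (U A B : 'M[C]_n) : U \is unitarymx ->
  (U^t* *m A *m U) *m (U^t* *m B *m U) = U^t* *m (A *m B) *m U.
Proof.
by move=> /unitarymxP hU; rewrite !mulmxA -(mulmxA _ U) hU mulmx1.
Qed.

(** [sqrtm] is a choice with default 0, so a positive root must be exhibited: take square roots of
    the eigenvalues. *)
Lemma sqrtmP n (A : 'M[C]_n) : psd A ->
  psd (sqrtm A) /\ sqrtm A *m sqrtm A = A.
Proof.
move=> hA; apply: (@xgetPex _ 0 [set X | psd X /\ X *m X = A]).
have [U [d [hU hd ->]]] := psd_spectral hA.
set s := diag_mx (\row_i sqrtC (d 0 i)).
have sE : s *m s = diag_mx d.
  rewrite mulmx_diag; congr diag_mx; apply/rowP => i.
  by rewrite !mxE -expr2 sqrtCK.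
exists (U^t* *m s *m U); split; last by rewrite (unitary_conjM _ _ hU) sE.
by apply: psd_conj_adj; apply: psd_diag => i; rewrite mxE sqrtC_ge0.
Qed.

Lemma sqrtm_adj n (A : 'M[C]_n) : psd A -> (sqrtm A)^t* = sqrtm A.
Proof. by move=> /sqrtmP[/psd_adj]. Qed.

(** With [S] the root of [B], the trace equals that of [S *m A *m S], which is positive. *)
Lemma psd_tr_mul_ge0 n (A B : 'M[C]_n) : psd A -> psd B -> 0 <= \tr (A *m B).
Proof.
move=> hA hB; have [hS <-] := sqrtmP hB.
rewrite mulmxA mxtrace_mulC mulmxA; apply: psd_tr_ge0.
by rewrite -{2}(sqrtm_adj hB); exact: psd_conj.
Qed.

Lemma loewnerP n (A B : 'M[C]_n) :
  loewner A B <-> forall X, psd X -> \tr (A *m X) <= \tr (B *m X).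
Proof.
have trB X : \tr (B *m X) - \tr (A *m X) = \tr ((B - A) *m X).
  by rewrite mulmxBl raddfB.
split=> [h X hX|h v]; first by rewrite -subr_ge0 trB; exact: psd_tr_mul_ge0.
rewrite tr_quad -trB subr_ge0; apply: h; exact: psd_outer.
Qed.

Lemma psdP n (A : 'M[C]_n) :
  psd A <-> forall X, psd X -> 0 <= \tr (A *m X).
Proof.
split=> [h X|h v]; first exact: psd_tr_mul_ge0.
by rewrite tr_quad; apply: h; exact: psd_outer.
Qed.

(** In an eigenbasis: each eigenvalue is at most the sum of all of them. *)
Lemma psd_le_trace n (A : 'M[C]_n) : psd A -> loewner A (\tr A)%:M.
Proof.
move=> /psd_spectral[U [d [hU hd ->]]].
have hU' : U^t* *m U = 1%:M by apply/mulmx1C/unitarymxP.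
rewrite mxtrace_mulC mulmxA (unitarymxP hU) mul1mx.
have -> : (\tr (diag_mx d))%:M = U^t* *m (\tr (diag_mx d))%:M *m U.
  by rewrite -scalemx1 -scalemxAr -scalemxAl mulmx1 hU'.
rewrite /loewner -mulmxBl -mulmxBr; apply: psd_conj_adj.
have -> : (\tr (diag_mx d))%:M - diag_mx d
    = diag_mx (\row_i (\tr (diag_mx d) - d 0 i)).
  apply/matrixP => i j; rewrite !mxE; case: eqP => _; last by rewrite subr0.
  by [].
apply: psd_diag => i; rewrite mxE mxtrace_diag (bigD1 i) //= addrAC subrr add0r.
exact: sumr_ge0.
Qed.

End Psd.

(** * Tensoring with the identity *)

Section Lift.

Variables (R : realType) (V : finType) (d : V -> nat).
Implicit Types (qs : {set V}) (x y z : Defs.Basis d).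
Local Notation C := (R[i]).
Local Notation Basis := (Basis d).
Local Notation op := (op R d).

Definition agree (qs : {set V}) (x y : Basis) : bool :=
  [forall q, (q \notin qs) ==> (val (x q) == val (y q))].

(** A section of [restr], and its inverse on labels agreeing with [x] outside [qs]. [inord] moves
    between ordinal types whose sizes are only provably equal. *)
Definition merge (qs : {set V}) (w : basis d qs) (x : Basis) : Basis :=
  [ffun q => if q \in qs then inord (w q) else x q].

Lemma agreeP qs x y :
  reflect (forall q, q \notin qs -> val (x q) = val (y q)) (agree qs x y).
Proof.
apply: (iffP forallP) => h q; first by move=> hq; have := h q; rewrite hq => /eqP.
by apply/implyP => hq; apply/eqP; exact: h.
Qed.

Lemma agreeC qs x y : agree qs x y = agree qs y x.
Proof. by apply/agreeP/agreeP => h q hq; rewrite h. Qed.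

Lemma agree_trans qs x y z : agree qs x y -> agree qs x z = agree qs y z.
Proof.
move=> /agreeP h; apply/agreeP/agreeP => h' q hq; first by rewrite -h ?h'.
by rewrite h ?h'.
Qed.

Lemma agree_merge qs (w : basis d qs) x : agree qs x (merge w x).
Proof. by apply/agreeP => q hq; rewrite ffunE (negbTE hq). Qed.

Lemma dim_inT qs q : q \in qs -> dim_in d qs q = dim_in d [set: V] q.
Proof. by move=> hq; rewrite /dim_in hq inE. Qed.

Lemma restrE qs (x : Basis) q : q \in qs -> val (restr qs x q) = val (x q).
Proof.
move=> hq; rewrite ffunE /= inordK //.
by rewrite (dim_inT hq) ltn_ord.
Qed.

Lemma mergeE qs (w : basis d qs) x q : q \in qs -> val (merge w x q) = val (w q).
Proof.
move=> hq; rewrite ffunE hq /= inordK //.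
by rewrite -(dim_inT hq) ltn_ord.
Qed.

Lemma basis_out qs (w : basis d qs) q : q \notin qs -> val (w q) = 0%N.
Proof.
move=> hq; have hd : dim_in d qs q = 0%N by rewrite /dim_in (negbTE hq).
by move: (w q); rewrite hd => i; rewrite ord1.
Qed.

Lemma basisP qs (w w' : basis d qs) :
  (forall q, q \in qs -> val (w q) = val (w' q)) -> w = w'.
Proof.
move=> h; apply/ffunP => q; apply: val_inj.
by have [/h//|hq] := boolP (q \in qs); rewrite !basis_out.
Qed.

Lemma restr_merge qs (w : basis d qs) x : restr qs (merge w x) = w.
Proof. by apply: basisP => q hq; rewrite restrE ?mergeE. Qed.

Lemma merge_restr qs x z : agree qs x z -> merge (restr qs z) x = z.
Proof.
move=> /agreeP h; apply/ffunP => q; apply: val_inj.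
have [hq|hq] := boolP (q \in qs); first by rewrite mergeE ?restrE.
by rewrite ffunE (negbTE hq) h.
Qed.

(** [merge] and [restr] put the labels agreeing with [x] outside [qs] in bijection with
    [basis d qs]. *)
Lemma sum_agree qs x (F : basis d qs -> C) :
  \sum_(z : Basis | agree qs x z) F (restr qs z) = \sum_w F w.
Proof.
rewrite (reindex_onto (fun w => merge w x) (restr qs)) /=; last first.
  by move=> z; exact: merge_restr.
by apply: eq_big => w; rewrite ?agree_merge restr_merge ?eqxx.
Qed.

Lemma sum_enum_rank (W : zmodType) (T : finType) (F : 'I_#|T| -> W) :
  \sum_k F k = \sum_(z : T) F (enum_rank z).
Proof.
rewrite (reindex (@enum_rank T)) //.
by exists enum_val => i _; rewrite (enum_rankK, enum_valK).
Qed.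

Lemma matrix_enumP (T : finType) (A B : 'M[C]_#|T|) :
  (forall s t, A (enum_rank s) (enum_rank t) = B (enum_rank s) (enum_rank t)) ->
  A = B.
Proof.
by move=> h; apply/matrixP => i j; rewrite -(enum_valK i) -(enum_valK j).
Qed.

Lemma liftE qs (A : op qs) x y :
  lift A (enum_rank x) (enum_rank y) =
  if agree qs x y then A (enum_rank (restr qs x)) (enum_rank (restr qs y)) else 0.
Proof. by rewrite mxE /= !enum_rankK. Qed.

(** Only intermediate labels agreeing with [x] outside [qs] contribute, and by [sum_agree] they
    reproduce the sum of the matrix product on [qs]. *)
Lemma liftM qs (A B : op qs) : lift (A *m B) = lift A *m lift B.
Proof.
apply: matrix_enumP => x y; rewrite liftE [RHS]mxE sum_enum_rank.
rewrite (bigID (agree qs x)) /= [X in _ = _ + X]big1 ?addr0; last first.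
  by move=> z /negbTE hz; rewrite liftE hz mul0r.
(* If [x] and [y] disagree outside [qs], no intermediate label agrees with both. *)
case: ifP => hxy; last first.
  by rewrite big1 // => z hz; rewrite !liftE -(agree_trans _ hz) hxy mulr0.
rewrite mxE sum_enum_rank -(sum_agree x); apply: eq_bigr => z hz.
by rewrite !liftE hz -(agree_trans _ hz) hxy.
Qed.

Lemma lift1 qs : lift (1%:M : op qs) = 1%:M.
Proof.
apply: matrix_enumP => x y; rewrite liftE !mxE !(inj_eq enum_rank_inj).
case: ifP => hxy.
  congr ((nat_of_bool _)%:R); apply/eqP/eqP => [e|-> //].
  by rewrite -(merge_restr hxy) -e merge_restr //; apply/agreeP.
by case: eqP => // e; rewrite e in hxy; move/agreeP: hxy; case.
Qed.

Lemma lift_adj qs (A : op qs) : (lift A)^t* = lift (A^t*).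
Proof.
apply: matrix_enumP => x y; rewrite adjE !liftE adjE agreeC.
by case: ifP => // _; rewrite rmorph0.
Qed.

Lemma liftD qs (A B : op qs) : lift (A + B) = lift A + lift B.
Proof.
apply: matrix_enumP => x y; rewrite [RHS]mxE !liftE mxE.
by case: ifP; rewrite ?addr0.
Qed.

Lemma lift0 qs : lift (0 : op qs) = 0.
Proof. by apply: matrix_enumP => x y; rewrite liftE !mxE if_same. Qed.

Lemma lift_sum qs (I : finType) (A : I -> op qs) :
  lift (\sum_i A i) = \sum_i lift (A i).
Proof. exact: (big_morph _ (@liftD qs) (lift0 qs)). Qed.

Lemma lift_psd qs (A : op qs) : psd A -> psd (lift A).
Proof.
move=> hA; have [hS <-] := sqrtmP hA.
by rewrite -{2}(sqrtm_adj hA) liftM -lift_adj; exact: psd_outer.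
Qed.

Lemma ketbra_adj qs (x y : basis d qs) : (ketbra R x y)^t* = ketbra R y x.
Proof. by rewrite trmx_delta map_delta_mx. Qed.

(** The completeness relation for the Kraus operators of initialisation. *)
Lemma sum_ketbra qs :
  \sum_(x : basis d qs) lift (ketbra R x (zero_lbl d qs)) *m
     lift (ketbra R (zero_lbl d qs) x) = 1%:M.
Proof.
rewrite -(lift1 qs) mx1_sum_delta sum_enum_rank lift_sum.
by apply: eq_bigr => x _; rewrite -liftM mul_delta_mx.
Qed.

End Lift.

(** * Convergence of matrix sequences *)

Section Limits.

Variable R : realType.
Local Notation C := (R[i]).
Local Open Scope classical_set_scope.

(** Stated on real and imaginary parts because [mlim] takes their limits separately. *)
Definition ccvg (u : nat -> C) (l : C) : Prop :=
  (fun n => complex.Re (u n)) @ \oo --> complex.Re l /\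
  (fun n => complex.Im (u n)) @ \oo --> complex.Im l.

Lemma ccvg_cst a : ccvg (fun=> a) a.
Proof. by split; exact: cvg_cst. Qed.

Lemma ccvg_ext u v l : u =1 v -> ccvg u l -> ccvg v l.
Proof. by move=> /funext ->. Qed.

Lemma ccvgD u v l m : ccvg u l -> ccvg v m -> ccvg (fun n => u n + v n) (l + m).
Proof.
by move=> [u1 u2] [v1 v2]; split; under eq_fun do rewrite raddfD;
  rewrite raddfD; exact: cvgD.
Qed.

Lemma ccvgM a u l : ccvg u l -> ccvg (fun n => a * u n) (a * l).
Proof.
have ReM (x y : C) : complex.Re (x * y) =
    complex.Re x * complex.Re y - complex.Im x * complex.Im y.
  by case: x => ? ?; case: y.
have ImM (x y : C) : complex.Im (x * y) =
    complex.Re x * complex.Im y + complex.Im x * complex.Re y.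
  by case: x => ? ?; case: y.
move=> [u1 u2]; split.
  under eq_fun do rewrite ReM; rewrite ReM.
  by apply: cvgB; apply: cvgMr.
under eq_fun do rewrite ImM; rewrite ImM.
by apply: cvgD; apply: cvgMr.
Qed.

Lemma ccvg_sum (I : Type) (r : seq I) (u : I -> nat -> C) (l : I -> C) :
  (forall i, ccvg (u i) (l i)) ->
  ccvg (fun n => \sum_(i <- r) u i n) (\sum_(i <- r) l i).
Proof.
move=> h; elim: r => [|i r IH].
  by rewrite big_nil; under eq_fun do rewrite big_nil; exact: ccvg_cst.
by rewrite big_cons; under eq_fun do rewrite big_cons; exact: ccvgD.
Qed.

Lemma ccvg_unique u l m : ccvg u l -> ccvg u m -> l = m.
Proof.
move=> [u1 u2] [v1 v2]; case: l m u1 u2 v1 v2 => [a b] [c e] /= u1 u2 v1 v2.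
by congr Complex; [exact: (cvg_unique _ u1 v1)|exact: (cvg_unique _ u2 v2)].
Qed.

Lemma ccvgS u l : ccvg u l -> ccvg (fun n => u n.+1) l.
Proof.
move=> [u1 u2]; split.
  by rewrite (cvg_shiftS (fun n => complex.Re (u n))).
by rewrite (cvg_shiftS (fun n => complex.Im (u n))).
Qed.

Lemma ccvg_ge0 u l : (forall n, 0 <= u n) -> ccvg u l -> 0 <= l.
Proof.
move=> h [u1 u2].
have h1 n : 0 <= complex.Re (u n) by have := h n; rewrite lecE => /andP[].
have h2 n : complex.Im (u n) = 0 by have := h n; rewrite lecE => /andP[/eqP].
rewrite lecE /=; apply/andP; split.
  have v2 : (fun n => complex.Im (u n)) @ \oo --> (0 : R).
    by under eq_fun do rewrite h2; exact: cvg_cst.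
  by apply/eqP; exact: (cvg_unique _ u2 v2).
have cu : cvgn (fun n => complex.Re (u n)) by apply/cvg_ex; exists (complex.Re l).
by rewrite -(cvg_lim _ u1) //; apply: limr_ge => //; apply: nearW.
Qed.

Lemma ccvg_le u v l m : (forall n, u n <= v n) -> ccvg u l -> ccvg v m -> l <= m.
Proof.
move=> h hu hv; rewrite -subr_ge0.
apply: (@ccvg_ge0 (fun n => v n + -1 * u n)) => [n|].
  by rewrite mulN1r subr_ge0.
by rewrite -[- l]mulN1r; apply: ccvgD => //; exact: ccvgM.
Qed.

(** Comparable complex numbers share their imaginary part, so that part is constant and the real
    part is a bounded increasing sequence. *)
Lemma ccvg_mono u M : (forall n, u n <= u n.+1) -> (forall n, u n <= M) ->
  exists l, ccvg u l.
Proof.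
move=> hu hM.
have h1 n : complex.Re (u n) <= complex.Re (u n.+1).
  by have := hu n; rewrite lecE => /andP[].
have h2 n : complex.Im (u n) = complex.Im M.
  by have := hM n; rewrite lecE => /andP[/eqP].
have hc : cvgn (fun n => complex.Re (u n)).
  apply: nondecreasing_is_cvgn; first by apply/nondecreasing_seqP.
  by exists (complex.Re M) => _ [n _ <-]; have := hM n; rewrite lecE => /andP[].
exists (Complex (limn (fun n => complex.Re (u n))) (complex.Im M)); split => //=.
by under eq_fun do rewrite h2; exact: cvg_cst.
Qed.

(** Convergence against all trace functionals; in finite dimension this is entrywise convergence, in
    the form suited to trace duality. *)
Definition mcvg m (A : nat -> 'M[C]_m) (L : 'M[C]_m) : Prop :=
  forall X, ccvg (fun n => \tr (A n *m X)) (\tr (L *m X)).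

Lemma mcvg_unique m (A : nat -> 'M[C]_m) L L' : mcvg A L -> mcvg A L' -> L = L'.
Proof. by move=> h h'; apply: psd_tr_inj => X _; exact: ccvg_unique (h X) (h' X). Qed.

Lemma mcvg_psd m (A : nat -> 'M[C]_m) L :
  (forall n, psd (A n)) -> mcvg A L -> psd L.
Proof.
move=> hA h; apply/psdP => X hX; apply: ccvg_ge0 (h X) => n.
exact: psd_tr_mul_ge0.
Qed.

End Limits.

(** * Existence of operator limits *)

Section MatrixLimit.

Variables (R : realType) (V : finType) (d : V -> nat).
Local Notation C := (R[i]).
Implicit Type A : nat -> Op R d.

(** Convergence against positive [X] spreads to all [X] by linearity. Matrix units then give
    convergence of the entries, and [mlim] collects their limits. *)
Lemma mcvg_mlim A :
  (forall X, psd X -> exists l, ccvg (fun n => \tr (A n *m X)) l) ->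
  mcvg A (mlim A).
Proof.
move=> h.
have hX X : exists l, ccvg (fun n => \tr (A n *m X)) l.
  move: X; apply: outer_span_ind => [v|a X Y [l hl] [m hm]].
    by apply: h; exact: psd_outer.
  exists (a * l + m); apply: ccvg_ext (ccvgD (ccvgM a hl) hm) => n /=.
  by rewrite mulmxDr -scalemxAr mxtraceD mxtraceZ.
have hij i j : ccvg (fun n => A n i j) (mlim A i j).
  have [l hl] := hX (delta_mx j i).
  have {}hl : ccvg (fun n => A n i j) l.
    by apply: ccvg_ext hl => n; exact: tr_mul_delta.
  (* [limn] is meaningful only for a convergent sequence; [hl] provides this for both parts. *)
  rewrite mxE; case: hl => h1 h2; split => /=.
    by apply/cvg_ex; exists (complex.Re l).
  by apply/cvg_ex; exists (complex.Im l).
move=> X.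
have trE (B : Op R d) : \tr (B *m X) = \sum_i \sum_j X j i * B i j.
  apply: eq_bigr => i _; rewrite mxE; apply: eq_bigr => j _; exact: mulrC.
rewrite trE; apply: (@ccvg_ext _ (fun n => \sum_i \sum_j X j i * A n i j)).
  by move=> n; rewrite trE.
by apply: ccvg_sum => i; apply: ccvg_sum => j; exact: ccvgM.
Qed.

Lemma mcvg_mono A :
  (forall n, loewner (A n) (A n.+1)) ->
  (forall X, psd X -> exists M, forall n, \tr (A n *m X) <= M) ->
  mcvg A (mlim A).
Proof.
move=> hA hM; apply: mcvg_mlim => X hX; have [M hMX] := hM X hX.
apply: ccvg_mono (hMX) => n.
by move/loewnerP: (hA n); apply.
Qed.

End MatrixLimit.

(** * Superoperators and their duals *)

(* Otherwise [done] unfolds [psd] goals and tries costly unifications. *)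
Local Opaque psd.

Section Superoperators.

Variables (R : realType) (V : finType) (d : V -> nat).
Local Notation C := (R[i]).
Local Notation Op := (Op R d).
Local Notation op := (Defs.op R d).
Implicit Types (rho A P Q X : Op) (f g : Op -> Op).

Definition is_dual f g : Prop :=
  forall A rho, is_pred A -> psd rho -> \tr (g A *m rho) = \tr (A *m f rho).

(* The dual [g] plays the role of the Heisenberg adjoint; only its values on
   predicates matter, so no linearity is demanded. *)
Definition qop f : Prop :=
  [/\ forall rho, psd rho -> psd (f rho),
      forall rho, psd rho -> \tr (f rho) <= \tr rho
    & exists g, is_dual f g].

Lemma is_predP A :
  is_pred A <-> forall X, psd X -> 0 <= \tr (A *m X) <= \tr X.
Proof.
split=> [[hA /loewnerP h1] X hX|h].
  have := h1 X hX; rewrite mul1mx => ->; rewrite andbT.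
  exact: psd_tr_mul_ge0.
split; first by apply/psdP => X /h/andP[].
by apply/loewnerP => X /h/andP[]; rewrite mul1mx.
Qed.

Lemma is_pred_compl A : is_pred A -> is_pred (1%:M - A).
Proof.
move=> /is_predP h; apply/is_predP => X hX.
rewrite mulmxBl mul1mx raddfB /= subr_ge0 gerBl.
by rewrite andbC; exact: h.
Qed.

(** On positive [X], the trace of [A *m f X] lies between 0 and that of [f X], which is at most that
    of [X]. *)
Lemma dual_pred f g A : qop f -> is_dual f g -> is_pred A -> is_pred (g A).
Proof.
move=> [f1 f2 _] hg hA; apply/is_predP => X hX; rewrite hg //.
move/is_predP: hA => /(_ _ (f1 _ hX))/andP[-> h] /=.
exact: le_trans h (f2 _ hX).
Qed.

(* The weakest liberal precondition of [Q] is [I - f^*(I - Q)]. *)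
Lemma wlp_exists f : qop f -> exists w : Op -> Op, forall Q, is_pred Q ->
  is_pred (w Q) /\ forall rho, psd rho ->
    \tr (w Q *m rho) = \tr (Q *m f rho) + \tr rho - \tr (f rho).
Proof.
move=> hf; have [_ _ [g hg]] := hf.
exists (fun Q => 1%:M - g (1%:M - Q)) => Q hQ.
have hQ' := is_pred_compl hQ.
split=> [|rho hrho]; first exact: is_pred_compl (dual_pred hf hg hQ').
rewrite mulmxBl mul1mx raddfB /= hg // mulmxBl mul1mx raddfB /=.
by rewrite opprB addrCA addrA.
Qed.

Lemma qop_id : qop id.
Proof. by split=> //; exists id. Qed.

Lemma qop_comp f1 f2 : qop f1 -> qop f2 -> qop (f2 \o f1).
Proof.
move=> h1 h2; have [p1 t1 [g1 d1]] := h1; have [p2 t2 [g2 d2]] := h2.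
split=> [rho hr|rho hr|]; first exact/p2/p1.
  exact: le_trans (t2 _ (p1 _ hr)) (t1 _ hr).
exists (g1 \o g2) => A rho hA hr /=.
by rewrite (d1 _ _ (dual_pred h2 d2 hA) hr) (d2 _ _ hA (p1 _ hr)).
Qed.

Lemma qop_iter f n : qop f -> qop (iter n f).
Proof.
by move=> hf; elim: n => [|n IH]; [exact: qop_id|exact: qop_comp IH hf].
Qed.

(** * Kraus maps: initialisation and unitaries *)

Lemma qop_kraus (I : finType) (K : I -> Op) :
  \sum_i (K i)^t* *m K i = 1%:M ->
  let f rho := \sum_i K i *m rho *m (K i)^t* in
  let g A := \sum_i (K i)^t* *m A *m K i in
  [/\ forall rho, psd rho -> psd (f rho), forall rho, \tr (f rho) = \tr rho
    & forall A rho, \tr (g A *m rho) = \tr (A *m f rho)].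
Proof.
move=> hK f g.
have fg A rho : \tr (g A *m rho) = \tr (A *m f rho).
  rewrite mulmx_suml mulmx_sumr !raddf_sum /=; apply: eq_bigr => i _.
  exact: mxtrace_cycle.
(* By duality, trace preservation of [f] amounts to [g] fixing the identity. *)
have g1 : g 1%:M = 1%:M.
  by rewrite -[RHS]hK; apply: eq_bigr => i _; rewrite mulmx1.
split; [move=> rho hr|move=> rho|exact: fg].
  by apply: psd_sum => i; exact: psd_conj.
by rewrite -[f rho]mul1mx -fg g1 mul1mx.
Qed.

Lemma sem_initE (qs : {set V}) rho :
  let K x := lift (ketbra R (zero_lbl d qs) x) in
  sem_init qs rho = \sum_x K x *m rho *m (K x)^t*.
Proof. by apply: eq_bigr => x _; rewrite lift_adj ketbra_adj. Qed.

Lemma init_preE (qs : {set V}) A :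
  let K x := lift (ketbra R (zero_lbl d qs) x) in
  init_pre qs A = \sum_x (K x)^t* *m A *m K x.
Proof. by apply: eq_bigr => x _; rewrite lift_adj ketbra_adj. Qed.

Lemma sem_init_facts (qs : {set V}) :
  [/\ forall rho, psd rho -> psd (sem_init qs rho),
      forall rho, \tr (sem_init qs rho) = \tr rho
    & forall A rho, \tr (init_pre qs A *m rho) = \tr (A *m sem_init qs rho)].
Proof.
have hK : \sum_x (lift (ketbra R (zero_lbl d qs) x))^t* *m
    lift (ketbra R (zero_lbl d qs) x) = 1%:M.
  rewrite -(sum_ketbra R d qs); apply: eq_bigr => x _.
  by rewrite lift_adj ketbra_adj.
have [h1 h2 h3] := qop_kraus hK.
split=> [rho hr|rho|A rho]; rewrite sem_initE; [exact: h1|exact: h2|].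
by rewrite init_preE; exact: h3.
Qed.

Lemma unitary_facts (qs : {set V}) (U : op qs) : U \is unitarymx ->
  let f rho := lift U *m rho *m (lift U)^t* in
  [/\ forall rho, psd rho -> psd (f rho), forall rho, \tr (f rho) = \tr rho
    & forall A rho, \tr ((lift U)^t* *m A *m lift U *m rho) = \tr (A *m f rho)].
Proof.
move=> /unitarymxP/mulmx1C hU f.
have hK : \sum_(i < 1) (lift U)^t* *m lift U = 1%:M.
  by rewrite big_ord1 lift_adj -liftM hU lift1.
have [h1 h2 h3] := qop_kraus hK.
split=> [rho hr|rho|A rho].
- by have := h1 rho hr; rewrite big_ord1.
- by have := h2 rho; rewrite big_ord1.
- by have := h3 A rho; rewrite !big_ord1.
Qed.

Lemma qop_trace_preserving f g :
  (forall rho, psd rho -> psd (f rho)) -> (forall rho, \tr (f rho) = \tr rho) ->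
  (forall A rho, \tr (g A *m rho) = \tr (A *m f rho)) -> qop f.
Proof.
by move=> h1 h2 h3; split=> // [rho _|]; [rewrite h2|exists g => A rho _ _].
Qed.

(** * Measurements and case distinction *)

Lemma meas_map_dual (qs : {set V}) (M : op qs) A rho :
  \tr (meas_map M A *m rho) = \tr (A *m meas_map M rho).
Proof. exact: mxtrace_cycle. Qed.

Lemma meas_map_psd (qs : {set V}) (M : op qs) rho :
  psd M -> psd rho -> psd (meas_map M rho).
Proof.
move=> hM hr; rewrite /meas_map /kr -{2}sqrtm_adj; last exact: lift_psd.
exact: psd_conj.
Qed.

Lemma meas_map_tr (qs : {set V}) (M : op qs) rho :
  psd M -> \tr (meas_map M rho) = \tr (lift M *m rho).
Proof.
move=> hM; rewrite /meas_map /kr mxtrace_mulC mulmxA.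
by have [_ ->] := sqrtmP (lift_psd hM).
Qed.

Lemma meas_sum_tr (qs : {set V}) k (M : 'I_k -> op qs) rho :
  is_meas M -> \sum_w \tr (meas_map (M w) rho) = \tr rho.
Proof.
move=> [hM hS]; under eq_bigr => w _ do rewrite meas_map_tr //.
by rewrite -raddf_sum /= -mulmx_suml -lift_sum hS lift1 mul1mx.
Qed.

Lemma bmeas0_psd (qs : {set V}) (B : op qs) rho :
  is_bin B -> psd rho -> psd (bmeas0 B rho).
Proof. by move=> [_ hB]; exact: meas_map_psd. Qed.

Lemma bmeas1_psd (qs : {set V}) (B : op qs) rho :
  is_bin B -> psd rho -> psd (bmeas1 B rho).
Proof. by move=> [hB _]; exact: meas_map_psd. Qed.

Lemma bmeas_sum_tr (qs : {set V}) (B : op qs) rho :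
  is_bin B -> \tr (bmeas0 B rho) + \tr (bmeas1 B rho) = \tr rho.
Proof.
move=> [hB hB']; rewrite /bmeas0 /bmeas1 !meas_map_tr // -raddfD /= -mulmxDl.
by rewrite -liftD subrK lift1 mul1mx.
Qed.

Lemma qop_case (qs : {set V}) k (M : 'I_k -> op qs) (f : 'I_k -> Op -> Op) :
  is_meas M -> (forall w, qop (f w)) ->
  qop (fun rho => \sum_w f w (meas_map (M w) rho)).
Proof.
move=> hM hf; have [hM' _] := hM; split=> [rho hr|rho hr|].
- by apply: psd_sum => w; have [h _ _] := hf w; exact/h/meas_map_psd.
- rewrite raddf_sum /= -(meas_sum_tr rho hM); apply: ler_sum => w _.
  by have [_ h _] := hf w; exact/h/meas_map_psd.
have /choice[g hg] : forall w, exists g, is_dual (f w) g.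
  by move=> w; have [_ _] := hf w.
exists (fun A => \sum_w meas_map (M w) (g w A)) => A rho hA hr.
rewrite mulmx_suml mulmx_sumr !raddf_sum /=; apply: eq_bigr => w _.
by rewrite meas_map_dual (hg w _ _ hA (meas_map_psd (hM' w) hr)).
Qed.

(** * The loop as a limit of its partial sums *)

Section Loop.

Variables (qs : {set V}) (B : op qs) (f : Op -> Op).
Hypotheses (hB : is_bin B) (hf : qop f).

Let h rho := f (bmeas1 B rho).
Definition loop_partial n rho := \sum_(k < n) bmeas0 B (iter k h rho).
(** Convertible with the [While] clause of [sem] when [f] is the semantics of the body. *)
Definition loop rho := mlim (fun n => loop_partial n rho).

Let h_psd rho : psd rho -> psd (h rho).
Proof. by case: hf => p _ _ hr; exact/p/bmeas1_psd. Qed.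

Let iter_psd k rho : psd rho -> psd (iter k h rho).
Proof. by move=> hr; elim: k => [|k IH]; [exact: hr|exact: h_psd IH]. Qed.

Lemma loop_partialS n rho :
  loop_partial n.+1 rho = bmeas0 B rho + loop_partial n (h rho).
Proof.
by rewrite /loop_partial big_ord_recl; congr (_ + _); apply: eq_bigr => k _;
  rewrite iterSr.
Qed.

Lemma loop_partial_psd n rho : psd rho -> psd (loop_partial n rho).
Proof. by move=> hr; apply: psd_sum => k; exact/bmeas0_psd/iter_psd. Qed.

(** The test splits the trace of [rho] into an exit part and a continuation part; the body and the
    remaining rounds do not increase the latter. *)
Lemma loop_partial_tr n rho : psd rho -> \tr (loop_partial n rho) <= \tr rho.
Proof.
elim: n rho => [|n IH] rho hr.
  by rewrite /loop_partial big_ord0 mxtrace0; exact: psd_tr_ge0.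
rewrite loop_partialS raddfD /= -(bmeas_sum_tr rho hB) lerD2l.
apply: le_trans (IH _ (h_psd hr)) _.
by case: hf => _ t _; exact/t/bmeas1_psd.
Qed.

Lemma loop_partial_mono n rho : psd rho ->
  loewner (loop_partial n rho) (loop_partial n.+1 rho).
Proof.
move=> hr; rewrite /loewner /loop_partial big_ord_recr /= addrAC subrr add0r.
exact/bmeas0_psd/iter_psd.
Qed.

Lemma loop_cvg rho : psd rho -> mcvg (loop_partial ^~ rho) (loop rho).
Proof.
move=> hr; apply: mcvg_mono => [n|X hX]; first exact: loop_partial_mono.
(* A partial sum lies below its trace times the identity, and that trace is at most the trace of
   [rho]. *)
exists (\tr rho * \tr X) => n.
have /psd_le_trace/loewnerP/(_ X hX) := loop_partial_psd n hr.
rewrite mul_scalar_mx mxtraceZ => /le_trans; apply.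
by rewrite ler_wpM2r ?psd_tr_ge0 ?loop_partial_tr.
Qed.

Lemma loop_psd rho : psd rho -> psd (loop rho).
Proof.
move=> hr; apply: mcvg_psd (loop_cvg hr) => n; exact: loop_partial_psd.
Qed.

(** Both sides are limits of the partial sums shifted by one round. *)
Lemma loop_unfold rho : psd rho -> loop rho = bmeas0 B rho + loop (h rho).
Proof.
move=> hr; apply: mcvg_unique (_ : mcvg (fun n => loop_partial n.+1 rho) _) _.
  by move=> X; exact: ccvgS (loop_cvg hr X).
move=> X; rewrite mulmxDl raddfD /=.
apply: (ccvg_ext _ (ccvgD (ccvg_cst _) (loop_cvg (h_psd hr) X))) => n.
by rewrite loop_partialS mulmxDl raddfD.
Qed.

Lemma loop_dual : exists g, is_dual loop g.
Proof.
have [pf tf [g hg]] := hf.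
(* [G A n] is the dual of [loop_partial n] at [A]; its recursion mirrors [loop_partialS], the first
   round being outermost. *)
pose G A := fix G n : Op := if n is m.+1 then bmeas0 B A + bmeas1 B (g (G m)) else 0.
have hG A n : is_pred A -> is_pred (G A n) /\
    forall rho, psd rho -> \tr (G A n *m rho) = \tr (A *m loop_partial n rho).
  move=> hA; elim: n => [|n [IH1 IH2]].
    split=> [|rho hr]; last by rewrite /loop_partial big_ord0 mul0mx mulmx0.
    by apply/is_predP => X hX; rewrite mul0mx mxtrace0 lexx psd_tr_ge0.
  (* Duality suffices: the trace bound on partial sums then makes [G A n.+1] a predicate. *)
  suff hd rho : psd rho -> \tr (G A n.+1 *m rho) = \tr (A *m loop_partial n.+1 rho).
    split; [apply/is_predP => X hX; rewrite hd //|exact: hd].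
    have /andP[-> /le_trans] := (is_predP A).1 hA _ (loop_partial_psd n.+1 hX).
    by apply; exact: loop_partial_tr.
  move=> hr; rewrite loop_partialS mulmxDr mulmxDl !raddfD /=; congr (_ + _).
    exact: meas_map_dual.
  rewrite -IH2; last exact: h_psd.
  by rewrite -(hg _ _ IH1 (bmeas1_psd hB hr)); exact: meas_map_dual.
exists (fun A => mlim (G A)) => A rho hA hr.
have hc : mcvg (G A) (mlim (G A)).
  apply: mcvg_mono => [n|X hX].
    apply/loewnerP => X hX; have [_ ->] := hG A n hA => //.
    have [_ ->] := hG A n.+1 hA => //.
    (* Swapping the factors lets the positive [A] test the monotonicity of the partial sums. *)
    rewrite ![\tr (A *m _)]mxtrace_mulC.
    have [pA _] := hA.
    exact: (loewnerP _ _).1 (loop_partial_mono n hX) A pA.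
  exists (\tr X) => n; have [hp _] := hG A n hA.
  by have /andP[] := (is_predP _).1 hp X hX.
(* Both traces are limits of the same sequence, by duality at every finite stage. *)
apply: ccvg_unique (hc rho) _.
rewrite mxtrace_mulC; apply: ccvg_ext (loop_cvg hr A) => n.
by have [_ ->] := hG A n hA => //; rewrite mxtrace_mulC.
Qed.

Lemma qop_loop : qop loop.
Proof.
split; [exact: loop_psd| |exact: loop_dual].
move=> rho hr; have := loop_cvg hr 1%:M; rewrite mulmx1 => hc.
apply: ccvg_le (_ : forall n, _ <= \tr rho) hc (ccvg_cst _) => n.
by rewrite mulmx1; exact: loop_partial_tr.
Qed.

End Loop.

Lemma qop_sem (S : prog R d) : concrete S -> wf S -> qop (sem S).
Proof.
elim: S => [|qs|qs U|S1 IH1 S2 IH2|N T IH|qs k M Sb IH|qs B T IH|L P Q] /=.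
- by move=> _ _; exact: qop_id.
- by move=> _ _; have [h1 h2 h3] := sem_init_facts qs; exact: qop_trace_preserving h3.
- by move=> _ /unitary_facts[h1 h2 h3]; exact: qop_trace_preserving h3.
- move=> [c1 c2] [w1 w2]; exact: qop_comp (IH1 c1 w1) (IH2 c2 w2).
- by move=> c w; exact: qop_iter (IH c w).
- move=> c [hM w]; exact: qop_case hM (fun v => IH v (c v) (w v)).
- move=> c [hB w]; exact: qop_loop hB (IH c w).
- by [].
Qed.

End Superoperators.

(** * Refinement *)

Section Refinement.

Variables (R : realType) (V : finType) (d : V -> nat).
Local Notation prog := (prog R d).
Local Notation Op := (Op R d).
Implicit Types S T : prog.

(** * Closure of refinement under program contexts *)

Lemma refines_trans S1 S2 S3 :
  refines_par S1 S2 -> refines_par S2 S3 -> refines_par S1 S3.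
Proof.
elim=> // T1 T2 T3 h _ IH h3; exact: rp_step h (IH h3).
Qed.

Lemma refines_step S T : rstep_par S T -> refines_par S T.
Proof. by move=> h; apply: rp_step h _; exact: rp_refl. Qed.

Lemma refines_ctx (F : prog -> prog) :
  (forall S T, rstep_par S T -> rstep_par (F S) (F T)) ->
  forall S T, refines_par S T -> refines_par (F S) (F T).
Proof.
move=> hF S T; elim=> [U|S1 S2 S3 h _ IH]; first exact: rp_refl.
exact: rp_step (hF _ _ h) IH.
Qed.

Lemma refines_seq S1 S1' S2 S2' : refines_par S1 S1' -> refines_par S2 S2' ->
  refines_par (Seq S1 S2) (Seq S1' S2').
Proof.
move=> h1 h2; apply: (refines_trans (S2 := Seq S1' S2)).
  exact: (refines_ctx (F := fun T => Seq T S2) (fun S T h => C_seqL S2 h) h1).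
exact: (refines_ctx (F := Seq S1') (fun S T h => C_seqR S1' h) h2).
Qed.

Lemma refines_branch (qs : {set V}) k (M : 'I_k -> op R d qs)
    (F : 'I_k -> prog) w S' :
  refines_par (F w) S' ->
  refines_par (Case M F) (Case M (fun v => if v == w then S' else F v)).
Proof.
(* [F] is generalised because every step replaces the family by one updated at [w]. *)
move eS : (F w) => S h; elim: h F eS => [T|S1 S2 S3 h _ IH] F eS.
  rewrite [X in refines_par _ (Case M X)](_ : _ = F); first exact: rp_refl.
  by apply/funext => v; case: eqP => // ->.
apply: rp_step (C_case M (w := w) _) _; first by rewrite eS; exact: h.
rewrite [X in refines_par _ (Case M X)](_ : _ =
    (fun v => if v == w then S3 else (fun v => if v == w then S2 else F v) v)).
  by apply: IH; rewrite eqxx.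
by apply/funext => v; case: eqP.
Qed.

Lemma refines_case (qs : {set V}) k (M : 'I_k -> op R d qs) (F G : 'I_k -> prog) :
  (forall w, refines_par (F w) (G w)) -> refines_par (Case M F) (Case M G).
Proof.
move=> h.
(* Branches are refined one at a time; [uniq] ensures that each is still untouched when its turn
   comes. *)
suff hs (s : seq 'I_k) : uniq s ->
    refines_par (Case M F) (Case M (fun v => if v \in s then G v else F v)).
  have := hs _ (enum_uniq 'I_k); congr refines_par; congr Case.
  by apply/funext => v; rewrite mem_enum.
elim: s => [_|w s IH /= /andP[ws us]]; first exact: rp_refl.
apply: refines_trans (IH us) _.
rewrite [X in refines_par _ (Case M X)](_ : _ =
    (fun v => if v == w then G w else (fun v => if v \in s then G v else F v) v)).
  by apply: refines_branch; rewrite (negbTE ws).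
by apply/funext => v; rewrite inE; case: eqP => [->|].
Qed.

(** Termination defects of consecutive programs add up: the intermediate trace [s] cancels. *)
Lemma addr_telescope (K : comPzRingType) (a s t u : K) :
  a + s - t + u - s = a + u - t.
Proof. by ring. Qed.

(* [par_valid] without the normalisation of the state; the two agree because
   both sides are linear functionals of the state. *)
Definition par_sat (P : Op) S (Q : Op) : Prop :=
  forall rho, psd rho ->
    \tr (P *m rho) <= \tr (Q *m sem S rho) + \tr rho - \tr (sem S rho).

(** The wlp turns the right-hand side into a trace functional of [rho], so the inequality survives
    rescaling [rho] to trace one. *)
Lemma par_valid_sat P S Q : qop (sem S) -> is_pred Q ->
  par_valid P S Q -> par_sat P S Q.
Proof.
move=> hS hQ hv; have [w hw] := wlp_exists hS; have [_ wE] := hw Q hQ.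
move=> rho hr; rewrite -wE //.
have t0 := psd_tr_ge0 hr.
(* A state of trace 0 cannot be rescaled, but it vanishes. *)
have [/eqP tr0|tn0] := boolP (\tr rho == 0).
  have hz X : psd X -> \tr (X *m rho) = 0 .
    move=> hX; apply/eqP; rewrite eq_le psd_tr_mul_ge0 // andbT mxtrace_mulC.
    have /loewnerP/(_ X hX) := psd_le_trace hr.
    by rewrite tr0 mul_scalar_mx scale0r mxtrace0.
  have -> : rho = 0.
    by apply: psd_tr_inj => X hX; rewrite mul0mx mxtrace0 mxtrace_mulC hz.
  by rewrite !mulmx0.
have tp : 0 < \tr rho by rewrite lt_def tn0.
have hs : pstate ((\tr rho)^-1 *: rho).
  split; last by rewrite mxtraceZ mulVf.
  by apply: psdZ => //; rewrite invr_ge0.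
have := hv _ hs; rewrite -wE; last exact: (proj1 hs).
by rewrite -!scalemxAr !mxtraceZ ler_pM2l ?invr_gt0.
Qed.

(** The index type [L] is quantified inside the induction because the body of a repetition is
    refined over [L * 'I_N]. *)
Lemma par_sat_refines S : concrete S -> wf S ->
  forall (L : Type) (P Q : L -> Op), (forall l, is_pred (Q l)) ->
  (forall l, par_sat (P l) S (Q l)) -> refines_par (Hole P Q) S.
Proof.
elim: S => [|qs|qs U|S1 IH1 S2 IH2|N T IH|qs k M Sb IH|qs B T IH|L P Q] /=.
- move=> _ _ L P Q hQ hP; apply/refines_step/H_skip => l; apply/loewnerP => X hX.
  by have := hP l X hX; rewrite /= addrK.
- move=> _ _ L P Q hQ hP; apply/refines_step/H_init => l; apply/loewnerP => X hX.
  have [_ h2 h3] := sem_init_facts R d qs.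
  by rewrite h3; have := hP l X hX; rewrite /= h2 addrK.
- move=> _ hU L P Q hQ hP; apply/refines_step/H_unit => // l; apply/loewnerP => X hX.
  have [_ h2 h3] := unitary_facts hU.
  by rewrite h3; have := hP l X hX; rewrite /= h2 addrK.
- move=> [c1 c2] [w1 w2] L P Q hQ hP.
  have q1 := qop_sem c1 w1; have q2 := qop_sem c2 w2.
  have [w hw] := wlp_exists q2.
  have hR l : is_pred (w (Q l)) by have [] := hw _ (hQ l).
  apply: rp_step (H_seq P Q hR) _.
  apply: refines_seq.
    apply: IH1 => // l X hX; have [p1 _ _] := q1.
    have [_ ->] := hw _ (hQ l); last exact: p1.
    by have := hP l X hX; rewrite /= addr_telescope.
  apply: IH2 => // l X hX; have [_ ->] := hw _ (hQ l) => //.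
- move=> c w L P Q hQ hP.
  have qT := qop_sem c w.
  have [wl hw] := wlp_exists qT.
  have hR l j : is_pred (iter j wl (Q l)).
    by elim: j => [|j IHj]; [exact: hQ|have [] := hw _ IHj].
  (* Iterating the wlp of the body gives the wlp of the iterated body. *)
  have hE l j X : psd X -> \tr (iter j wl (Q l) *m X) =
      \tr (Q l *m iter j (sem T) X) + \tr X - \tr (iter j (sem T) X).
    elim: j X => [|j IHj] X hX /=; first by rewrite addrK.
    have [_ ->] := hw _ (hR l j) => //.
    have [pT _ _] := qT.
    rewrite IHj; last exact: pT.
    rewrite -iterSr /=.
    by rewrite addr_telescope.
  (* Indices run backwards: [N - j] rounds remain after [j] of them, so [Rr l N] is the
     postcondition. *)
  pose Rr l j := iter (N - j) wl (Q l).
  apply: rp_step (@H_repeat _ _ _ _ P Q N Rr _ _ _) _.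
  + by move=> l j _; exact: hR.
  + move=> l; apply/loewnerP => X hX; rewrite /Rr subn0 hE //; exact: hP.
  + by move=> l; rewrite /Rr subnn /loewner subrr; exact: psd0.
  apply: (refines_ctx (F := Repeat N)) => [S1 S2|]; first exact: C_repeat.
  apply: IH => // [[l j]|[l j] X hX] /=; first exact: hR.
  rewrite /Rr (_ : N - j = (N - j.+1).+1)%N; last by rewrite -subSn // subSS.
  by have [_ ->] := hw _ (hR l (N - j.+1)%N).
- move=> c [hM w] L P Q hQ hP; have [hM' _] := hM.
  have /choice[wl hw] : forall v, exists wl : Op -> Op, forall Q, is_pred Q ->
      is_pred (wl Q) /\ forall rho, psd rho ->
      \tr (wl Q *m rho) = \tr (Q *m sem (Sb v) rho) + \tr rho - \tr (sem (Sb v) rho).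
    by move=> v; apply: wlp_exists; exact: qop_sem.
  apply: rp_step (@H_case _ _ _ _ P Q qs k M (fun l v => wl v (Q l)) hM _ _) _.
  + by move=> l v; have [] := hw v _ (hQ l).
  + move=> l; apply/loewnerP => X hX; apply: le_trans (hP l X hX) _ => /=.
    (* Self-duality moves the measurement onto the state; the traces of the measured states then add
       up to that of [X]. *)
    have hE v : \tr (meas_map (M v) (wl v (Q l)) *m X) =
        \tr (Q l *m sem (Sb v) (meas_map (M v) X)) + \tr (meas_map (M v) X)
        - \tr (sem (Sb v) (meas_map (M v) X)).
      have [_ h] := hw v _ (hQ l).
      by rewrite meas_map_dual; exact: h (meas_map_psd (hM' v) hX).
    rewrite mulmx_suml mulmx_sumr !(raddf_sum mxtrace) -(meas_sum_tr X hM).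
    rewrite (eq_bigr _ (fun v _ => hE v)) sumrB big_split /=.
    exact: lexx.
  apply: refines_case => v; apply: IH => // l X hX.
  by have [_ ->] := hw v _ (hQ l).
- move=> c [hB w] L P Q hQ hP.
  have qT := qop_sem c w; have [pT _ _] := qT.
  have [wl hw] := wlp_exists qT.
  have [wW hwW] := wlp_exists (qop_loop hB qT).
  have hWp l : is_pred (wW (Q l)) by have [] := hwW _ (hQ l).
  (* The rule's predicate R is the wlp of the body with respect to the wlp of
     the loop; the fixpoint equation then makes the postcondition of the body
     equal to the wlp of the loop. *)
  have hWE l : wW (Q l) = bmeas0 B (Q l) + bmeas1 B (wl (wW (Q l))).
    (* Tested on [X], the equation is the unfolding of the loop by one round, with the trace of [X]
       split by the test. *)
    apply: psd_tr_inj => X hX; have hX1 := bmeas1_psd hB hX.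
    have [_ hE] := hwW _ (hQ l); have [_ hE'] := hw _ (hWp l).
    rewrite mulmxDl raddfD /= !meas_map_dual (hE' _ hX1) (hE _ (pT _ hX1)).
    rewrite (hE _ hX) (loop_unfold hB qT hX) mulmxDr !raddfD /=.
    by rewrite -(bmeas_sum_tr X hB); ring.
  apply: rp_step (@HP_while _ _ _ _ P Q qs B (fun l => wl (wW (Q l))) hB _ _) _.
  + by move=> l; have [] := hw _ (hWp l).
  + move=> l; rewrite -hWE; apply/loewnerP => X hX.
    by have [_ ->] := hwW _ (hQ l) => //; exact: hP.
  apply: (refines_ctx (F := While B)) => [S1 S2|]; first exact: C_while.
  apply: (IH c w) => [l|l X hX]; rewrite -hWE; first exact: hWp.
  by have [_ h] := hw _ (hWp l); rewrite (h _ hX).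
- by [].
Qed.

End Refinement.

Theorem mainTheorem3 (R : realType) (V : finType) (d : V -> nat)
  (P Q : Op R d) (S : prog R d) :
  is_pred P -> is_pred Q -> concrete S -> wf S ->
  par_valid P S Q ->
  refines_par (hole1 P Q) S.
Proof.
move=> _ hQ cS wS hv; apply: (par_sat_refines cS wS (fun=> hQ)) => _.
exact: par_valid_sat (qop_sem cS wS) hQ hv.
Qed.
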